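(* Let $\theta>0$ and $n\ge1$. Under the Ewens-like distribution for records with parameter $\theta$ on $\mathfrak{S}_n$, for every $j\in[n]$ and every integer $k\in[0,j-1]$, $$\mathbb{P}_n\big(\mathrm{inv}_j(\sigma)=k\big)=\begin{cases}\dfrac{\theta}{\theta+j-1}&\text{if }k=0,\\[2mm]\dfrac{1}{\theta+j-1}&\text{if }k\neq0.\end{cases}$$
   Context: $\mathfrak{S}_n$ is the set of permutations of $[n]=\{1,\dots,n\}$. An inversion of $\sigma$ is a pair $(i,j)$ with $i<j$ and $\sigma(i)>\sigma(j)$; $\mathrm{inv}_j(\sigma)=|\{i\in[j-1]:\sigma(i)>\sigma(j)\}|$. A permutation has a record at position $i$ if $\sigma(i)>\sigma(j)$ for all $j<i$; $\mathrm{rec}(\sigma)$ is the number of records. The Ewens-like distribution for records with parameter $\theta>0$ gives each $\sigma\in\mathfrak{S}_n$ probability proportional to $\theta^{\mathrm{rec}(\sigma)}$; $\mathbb{P}_n$ denotes probability under it. *)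

(* Defs.v *)
From mathcomp Require Import all_boot all_order all_fingroup all_algebra.
From mathcomp Require Import reals.

Set Implicit Arguments.
Unset Strict Implicit.
Unset Printing Implicit Defensive.

Import Order.TTheory GRing.Theory Num.Theory.
Local Open Scope ring_scope.

(* Permutations of {1, ..., n} are elements of 'S_n, i.e. permutations of
   'I_n = {0, ..., n - 1}: positions and values are both shifted down by one,
   which changes neither inversions nor records. *)

Definition inv_at (n : nat) (s : 'S_n) (j : 'I_n) : nat :=
  #|[set i : 'I_n | (i < j)%N && (s j < s i)%N]|.

Definition is_record (n : nat) (s : 'S_n) (i : 'I_n) : bool :=
  [forall j : 'I_n, (j < i)%N ==> (s j < s i)%N].

Definition nrec (n : nat) (s : 'S_n) : nat :=
  #|[set i : 'I_n | is_record s i]|.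

Definition ewens_mass (R : realType) (theta : R) (n : nat) (s : 'S_n) : R :=
  theta ^+ nrec s / \sum_(t : 'S_n) theta ^+ nrec t.

Definition ewens_prob (R : realType) (theta : R) (n : nat)
    (A : {set 'S_n}) : R :=
  \sum_(s in A) ewens_mass theta s.

(* Main.v *)
(* The Lehmer code s |-> (inv_at s i)_i is a bijection from 'S_n onto the
   sequences c with c i <= i, and i is a record of s iff c i = 0. Hence the
   weight theta ^ rec(s) is a product over positions of a function of c i, so
   that the entries of the code are independent, with the i-th one equal to k
   with probability proportional to theta if k = 0 and to 1 otherwise.
   The code is injective because two permutations have different entries in
   their codes at the last position where they differ; surjectivity follows by
   counting. *)
Require Import Defs.
From mathcomp Require Import all_boot all_order all_fingroup all_algebra.
From mathcomp Require Import reals.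
Import Order.TTheory GRing.Theory Num.Theory.
Local Open Scope ring_scope.

Lemma card_ord_ltn {n m : nat} :
  (m <= n)%N -> #|[pred k : 'I_n | (k < m)%N]| = m.
Proof.
move=> le_mn; rewrite -sum1_card -(big_ord_widen n (fun=> 1%N)) //.
by rewrite sum1_card card_ord.
Qed.

Lemma inv_at_leq {n : nat} (s : 'S_n) (j : 'I_n) : (inv_at s j <= j)%N.
Proof.
rewrite -[leqRHS](card_ord_ltn (ltnW (ltn_ord j))).
by apply/subset_leq_card/subsetP => i; rewrite !inE => /andP[].
Qed.

Lemma is_record_inv_at {n : nat} (s : 'S_n) (j : 'I_n) :
  is_record s j = (inv_at s j == 0%N).
Proof.
rewrite /inv_at cards_eq0; apply/forallP/eqP => [recj | inv0 i].
  apply/setP => i; rewrite !inE; apply/negP => /andP[lt_ij].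
  by rewrite ltnNge ltnW // (implyP (recj i)).
apply/implyP => lt_ij; have := in_set0 i; rewrite -inv0 inE lt_ij /= => /negbT.
rewrite -leqNgt leq_eqVlt => /orP[/eqP/val_inj/perm_inj eq_ij|//].
by rewrite eq_ij ltnn in lt_ij.
Qed.

(** Counting by value rather than by position lets the inversions of two permutations be compared as
    subsets of one set. *)
Lemma inv_at_values {n : nat} (s : 'S_n) (j : 'I_n) :
  inv_at s j = #|[set v | ((s^-1)%g v < j)%N && (s j < v)%N]|.
Proof.
rewrite -[LHS](card_imset _ (@perm_inj _ s)); apply: eq_card => v.
by rewrite -{1}(permKV s v) (mem_imset _ _ (@perm_inj _ s)) !inE permKV.
Qed.

(** Up to position [j] both permutations use the same values. Those counted for [t] exceed [t j],
    hence [s j], so they are counted for [s] too; the value [t j] is counted for [s] only. *)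
Lemma inv_at_ltn {n : nat} {s t : 'S_n} {j : 'I_n} :
  (forall i : 'I_n, (j < i)%N -> s i = t i) -> (s j < t j)%N ->
  (inv_at t j < inv_at s j)%N.
Proof.
move=> eq_st lt_st; rewrite !inv_at_values; apply/proper_card/properP.
have below v : ((t^-1)%g v <= j)%N -> s j != v -> ((s^-1)%g v < j)%N.
  move=> le_tv ne_v; rewrite ltn_neqAle; apply/andP; split.
    by apply: contraNneq ne_v => /val_inj <-; rewrite permKV.
  rewrite leqNgt; apply: contraL le_tv => lt_j; rewrite -ltnNge.
  by have := eq_st _ lt_j; rewrite permKV => {1}->; rewrite permK.
split.
  apply/subsetP => v; rewrite !inE => /andP[lt_tv lt_v].
  have lt_sv := ltn_trans lt_st lt_v; rewrite lt_sv andbT.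
  by apply: below; [exact: ltnW | rewrite -val_eqE neq_ltn lt_sv].
exists (t j); rewrite !inE ?ltnn ?andbF // lt_st andbT.
by apply: below; rewrite ?permK // -val_eqE neq_ltn lt_st.
Qed.

Lemma inv_at_inj {n : nat} (s t : 'S_n) : inv_at s =1 inv_at t -> s = t.
Proof.
move=> eq_inv; apply/permP => i0; apply/eqP/negPn/negP => ne_i0.
case: (@arg_maxnP _ i0 (fun i => s i != t i) val ne_i0) => j ne_j max_j.
have eq_st (i : 'I_n) : (j < i)%N -> s i = t i.
  by move=> lt_ji; apply: contraTeq lt_ji => /max_j; rewrite -leqNgt.
move: ne_j; rewrite -val_eqE neq_ltn => /orP[] /inv_at_ltn;
  by rewrite eq_inv ltnn => lt_inv; suff: false by []; apply: lt_inv => i /eq_st.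
Qed.

(** The common codomain ['I_n] avoids dependent types; the sharper bound by [i] reappears as a
    [family]. *)
Definition lehmer_code {n : nat} (s : 'S_n) : {ffun 'I_n -> 'I_n} :=
  [ffun i => Ordinal (leq_ltn_trans (inv_at_leq s i) (ltn_ord i))].

Lemma lehmer_code_inj {n : nat} : injective (@lehmer_code n).
Proof.
move=> s t /ffunP eq_code; apply: inv_at_inj => i.
by have /(congr1 val) := eq_code i; rewrite !ffunE.
Qed.

Lemma lehmer_code_image (n : nat) :
  [set lehmer_code s | s : 'S_n] =i
    family (fun i : 'I_n => [pred k : 'I_n | (k <= i)%N]).
Proof.
apply/subset_cardP; last first.
  apply/subsetP => _ /imsetP[s _ ->]; apply/familyP => i.
  by rewrite ffunE inE /= inv_at_leq.
rewrite card_imset; last exact: lehmer_code_inj.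
(* Both sides have n! elements: position [i] allows [i.+1] code entries. *)
rewrite card_Sn card_family foldrE big_map big_enum /=.
rewrite fact_prod big_add1 big_mkord; apply: eq_bigr => i _.
exact/esym/(@card_ord_ltn n i.+1).
Qed.

(** Expanding the product of sums gives one term per code. The weight may depend on the position so
    that an event at a single [j] can be encoded in it. *)
Lemma sum_prod_inv_at {R : comNzRingType} {n : nat} (w : 'I_n -> nat -> R) :
  \sum_(s : 'S_n) \prod_i w i (inv_at s i) =
    \prod_(i < n) \sum_(k < i.+1) w i k.
Proof.
transitivity (\prod_(i < n) \sum_(k : 'I_n | (k <= i)%N) w i k); last first.
  by apply: eq_bigr => i _; rewrite (big_ord_widen n (w i)).
rewrite bigA_distr_big_dep /= -(eq_bigl _ _ (lehmer_code_image n)).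
rewrite big_imset /=; last by move=> s t _ _; apply: lehmer_code_inj.
by apply: eq_bigr => s _; apply: eq_bigr => i _; rewrite ffunE.
Qed.

Lemma expr_nrec {R : comNzRingType} (theta : R) {n : nat} (s : 'S_n) :
  theta ^+ nrec s = \prod_i (if inv_at s i == 0%N then theta else 1).
Proof.
rewrite /nrec -big_mkcond /= -prodr_const; apply: eq_bigl => i.
by rewrite inE is_record_inv_at.
Qed.

Lemma sum_record_weight (R : comNzRingType) (theta : R) (m : nat) :
  \sum_(k < m.+1) (if k == 0%N :> nat then theta else 1) = theta + m%:R.
Proof. by rewrite big_ord_recl /= sumr_const card_ord. Qed.

(* The 0-based position j : 'I_n is the 1-based position j + 1, so that
   theta + j%:R is the usual theta + j - 1 and (k <= j)%N the usual k <= j - 1. *)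
Theorem theorem4 (R : realType) (theta : R) (n : nat)
    (theta_gt0 : 0 < theta) (n_ge1 : (1 <= n)%N)
    (j : 'I_n) (k : nat) (k_le : (k <= j)%N) :
  ewens_prob theta [set s : 'S_n | inv_at s j == k] =
    if k == 0%N then theta / (theta + j%:R) else 1 / (theta + j%:R).
Proof.
pose u (m : nat) : R := if m == 0%N then theta else 1.
have pos (i : 'I_n) : theta + i%:R != 0 by rewrite gt_eqF // ltr_pwDl.
(* The indicator of the event is absorbed into the factor at [j], which keeps the numerator a
   product. *)
pose w (i : 'I_n) (m : nat) := if (i == j) && (m != k) then 0 else u m.
have numE : \sum_(s in [set s : 'S_n | inv_at s j == k]) theta ^+ nrec s =
    \sum_(s : 'S_n) \prod_i w i (inv_at s i).
  rewrite big_mkcond; apply: eq_bigr => s _; rewrite inE.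
  have [eq_k | ne_k] := eqVneq (inv_at s j) k; last first.
    by rewrite (bigD1 j) //= /w eqxx ne_k mul0r.
  rewrite expr_nrec; apply: eq_bigr => i _; rewrite /w.
  by have [->|] := eqVneq i j; rewrite ?eq_k ?eqxx.
have sum_wj : \sum_(m < j.+1) w j m = u k.
  rewrite (bigD1 (Ordinal (k_le : k < j.+1)%N)) //= big1 => [|m ne_m].
    by rewrite /w !eqxx addr0.
  by rewrite /w eqxx -[_ != k]/(m != Ordinal (k_le : k < j.+1)%N) ne_m.
rewrite /ewens_prob /ewens_mass -mulr_suml numE.
rewrite (eq_bigr _ (fun s _ => expr_nrec theta s)).
rewrite sum_prod_inv_at (sum_prod_inv_at (fun=> u)).
rewrite (bigD1 j) //= [X in _ / X = _](bigD1 j) //= sum_wj sum_record_weight.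
(* Away from [j] the numerator and denominator share their factors, which are nonzero by [pos] and
   cancel. *)
have -> : \prod_(i < n | i != j) \sum_(m < i.+1) w i m =
    \prod_(i < n | i != j) \sum_(m < i.+1) u m.
  by apply: eq_bigr => i /negPf ne_i; rewrite /w ne_i.
rewrite -mulf_div divff ?mulr1; first by rewrite /u; case: ifP.
by apply/prodf_neq0 => i _; rewrite sum_record_weight.
Qed.
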